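(* For every $n\ge1$, the restriction of the map $\Phi$ to alternating permutations of $[2n]$ (i.e. permutations $\pi_1\cdots\pi_{2n}$ of $[2n]$, all entries positive, with $\pi_1>\pi_2<\pi_3>\cdots>\pi_{2n}$) is a bijection onto the set of labeled Dyck paths of length $2n$ (labeled ballot paths of length $2n$ ending on the $x$-axis); equivalently the inverse map $\Phi^{-1}$ sends labeled Dyck paths of length $2n$ to snakes with no negative entries. Consequently $B(2n,0)=E_{2n}$, the number of alternating permutations of $[2n]$.
   Context: A signed permutation of $[n]$ is a permutation of $[n]$ with some entries negated ($\bar i=-i$), ordered by $\bar n<\cdots<\bar1<1<\cdots<n$; a snake of type $B_n$ is one with $0<\pi_1>\pi_2<\pi_3>\cdots\pi_n$. A labeled ballot path $(P;W)$, $P=p_1\cdots p_n$, $W=w_1\cdots w_n$, is a lattice path from $(0,0)$ with steps $u=(1,1)$, $d=(1,-1)$ never going below the $x$-axis, with integer labels $0\le w_i\le$ height of $p_i$, the height of a step being the smaller $y$-coordinate of its endpoints. $B(n,k)$ counts labeled ballot paths ending at $(n,k)$. Inversion code: for a snake $\pi$ of type $B_n$ and $1\le i\le n$, if $n$ is odd let $c_i(\pi)$ be the number of $k$ with $1\le k\le (n-1)/2$, $i<2k$ and $\pi_{2k}<\pi_i<\pi_{2k+1}$; if $n$ is even let $c_i(\pi)$ be the number of $k$ with $1\le k\le n/2$, $i<2k-1$ and $\pi_{2k}<\pi_i<\pi_{2k-1}$. The map $\Phi$ (a bijection from snakes of type $B_n$ to labeled ballot paths of length $n$): for $k=1,\dots,n$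 let $i$ be the position with $\pi_i\in\{n-k+1,\overline{n-k+1}\}$. If $\pi_i=n-k+1$, set $p_k=u$ if $i$ is odd and $p_k=d$ if $i$ is even, and $w_k=c_i(\pi)$. If $\pi_i=\overline{n-k+1}$, set $p_k=d$ if $i$ is odd and $p_k=u$ if $i$ is even, and $w_k=h_k-c_i(\pi)$ where $h_k$ is the height of the $k$-th step in $p_1\cdots p_k$. Then $\Phi(\pi)=(p_1\cdots p_n;w_1\cdots w_n)$. *)

(* Defs.v *)
From HB Require Import structures.
From mathcomp Require Import all_boot all_order all_algebra.
Set Implicit Arguments. Unset Strict Implicit. Unset Printing Implicit Defensive.
Import Order.TTheory GRing.Theory Num.Theory.

(* Signed permutations of [n] are represented as sequences of integers
   (1-indexed positions in the paper: pi_i = nth 0 pi i.-1).  The order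
   nbar < ... < 1bar < 1 < ... < n is the usual order on int. *)

Definition pe (pi : seq int) (i : nat) : int := nth 0%R pi i.-1.

Definition signed_perm (n : nat) (pi : seq int) : bool :=
  perm_eq (map absz pi) (iota 1 n).

Definition zigzag (pi : seq int) : bool :=
  all (fun i => if odd i then (pe pi i > pe pi i.+1)%R else (pe pi i < pe pi i.+1)%R)
      (iota 1 (size pi).-1).

Definition snake (n : nat) (pi : seq int) : bool :=
  [&& signed_perm n pi, (0 < pe pi 1)%R & zigzag pi].

Definition alternating (n : nat) (pi : seq int) : bool :=
  [&& signed_perm n pi, all (fun x => 0 < x)%R pi & zigzag pi].

Definition euler_num (n : nat) : nat :=
  count (fun s : seq nat => alternating n (map Posz s)) (permutations (iota 1 n)).

(* ---- Lattice paths: true = u = (1,1), false = d = (1,-1) ---- *)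

Definition yht (P : seq bool) (j : nat) : int :=
  (\sum_(s <- take j P) (if s then 1 else -1))%R.

(* height of the k-th step (1-indexed): smaller y-coordinate of its endpoints *)
Definition step_height (P : seq bool) (k : nat) : int :=
  if nth false P k.-1 then yht P k.-1 else (yht P k.-1 - 1)%R.

Definition labeled_ballot (P : seq bool) (W : seq nat) : bool :=
  [&& size W == size P,
      all (fun j => 0 <= yht P j)%R (iota 0 (size P).+1) &
      all (fun k => (Posz (nth 0%N W k.-1) <= step_height P k)%R) (iota 1 (size P))].

Definition labeled_ballot_to (n k : nat) (PW : seq bool * seq nat) : bool :=
  [&& labeled_ballot PW.1 PW.2, size PW.1 == n & yht PW.1 n == Posz k].

Definition labeled_dyck (n : nat) (PW : seq bool * seq nat) : bool :=
  labeled_ballot_to n 0 PW.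

(* B(n,k): number of labeled ballot paths ending at (n,k).  Labels are at most
   the height of a step, hence < n+1, so n.-tuples over 'I_n.+1 enumerate all
   possible label sequences. *)
Definition B (n k : nat) : nat :=
  #|[set pw : n.-tuple bool * n.-tuple 'I_n.+1 |
      labeled_ballot_to n k (val pw.1, map (@nat_of_ord _) (val pw.2))]|.

Definition inv_code (pi : seq int) (i : nat) : nat :=
  let n := size pi in
  if odd n then
    count (fun k => (i < 2 * k) && (pe pi (2 * k) < pe pi i < pe pi (2 * k).+1)%R)
          (iota 1 (n.-1 %/ 2))
  else
    count (fun k => (i < (2 * k).-1) && (pe pi (2 * k) < pe pi i < pe pi (2 * k).-1)%R)
          (iota 1 (n %/ 2)).

Definition pos_of (pi : seq int) (v : nat) : nat :=
  (find (fun x => absz x == v) pi).+1.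

Definition Phi_path (pi : seq int) : seq bool :=
  let n := size pi in
  map (fun k => let i := pos_of pi (n - k + 1) in
                if (0 < pe pi i)%R then odd i else ~~ odd i)
      (iota 1 n).

(* For negative entries, w_k = h_k - c_i (h_k >= 0 on ballot paths; natural
   truncated subtraction is used, which is exact whenever Phi is well defined). *)
Definition Phi_labels (pi : seq int) : seq nat :=
  let n := size pi in
  let P := Phi_path pi in
  map (fun k => let i := pos_of pi (n - k + 1) in
                if (0 < pe pi i)%R then inv_code pi i
                else (absz (step_height P k) - inv_code pi i)%N)
      (iota 1 n).

Definition Phi (pi : seq int) : seq bool * seq nat := (Phi_path pi, Phi_labels pi).

(* Main.v *)
Require Import Defs.
From HB Require Import structures.
From mathcomp Require Import all_boot all_order all_algebra zify.
Set Implicit Arguments. Unset Strict Implicit. Unset Printing Implicit Defensive.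
Import Order.TTheory GRing.Theory Num.Theory.

(** Cut an alternating permutation of [2n] into blocks (peak, valley) and insert
    its values in the order 2n, 2n-1, ..., 1.  A peak opens a block and a valley
    closes one, so the height of the path is the number of open blocks, and the
    label of a value is the number of open blocks to its right.  Since the valley
    of a block is smaller than the next peak, nothing can be inserted just after a
    closed block: a new block goes to the far left or just after an open block.
    With m open blocks this leaves m+1 places for a peak and m for a valley, one
    for each admissible label, so the path and its labels determine, and can be
    chosen to prescribe, every insertion. *)

(** * Block lists, partial insertions and their words *)

Implicit Types (b c : nat * nat) (s t l r : seq (nat * nat)) (v w y N : nat).

Definition flat t : seq nat := flatten [seq [:: b.1; b.2] | b <- t].
Definition has_val x b := (b.1 == x) || (b.2 == x).
Definition straddles x b := b.2 < x < b.1.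
Definition code x t := count (straddles x) (drop (find (has_val x) t).+1 t).
Definition nopen t := count (fun b => b.2 == 0) t.
Definition link b c := b.2 < c.1.
(* The default value makes the empty list end open. *)
Definition ends_open l := (last (0, 0) l).2 == 0.

(* The values v+1, ..., N have been inserted.  A valley equal to 0 stands for an
   open block: 0 is below all values, so the inequalities of an alternating
   permutation and the inversion code need no case distinction. *)
Definition state v N t : Prop :=
  [/\ forall x, 0 < x -> count_mem x (flat t) = (v < x <= N),
      all (fun b => b.2 < b.1) t & path link (0, 0) t].

(** Values are read in the order of insertion, so lowering [v] appends letters on the right. For an
    alternating permutation the word at [v = 0] is the path of [Phi] zipped with its labels. *)
Definition word v N t : seq (bool * nat) :=
  [seq (x \in unzip1 t, code x t) | x <- rev (iota v.+1 (N - v))].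

Lemma flat_cat l r : flat (l ++ r) = flat l ++ flat r.
Proof. by rewrite /flat map_cat flatten_cat. Qed.

Lemma flat_cons b t : flat (b :: t) = b.1 :: b.2 :: flat t.
Proof. by []. Qed.

Arguments flat : simpl never.

Lemma mem_flat x t : (x \in flat t) = has (has_val x) t.
Proof.
elim: t => //= b t IH; rewrite flat_cons !inE IH /has_val.
by rewrite -orbA (eq_sym x) (eq_sym x).
Qed.

Lemma nopen_cons b t : nopen (b :: t) = (b.2 == 0) + nopen t.
Proof. by []. Qed.

Arguments nopen : simpl never.

Lemma nopen_cat l r : nopen (l ++ r) = nopen l + nopen r.
Proof. exact: count_cat. Qed.

Lemma ends_open_gt0 b l : ends_open (b :: l) -> 0 < nopen (b :: l).
Proof.
rewrite /ends_open /nopen => h; rewrite -has_count; apply/hasP.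
by exists (last b l); rewrite ?mem_last.
Qed.

(** * Opening or closing a block at a prescribed label *)

Fixpoint open_block v w s :=
  if nopen s == w then (v, 0) :: s
  else if s is b :: s' then b :: open_block v w s' else [::].

Fixpoint close_block v w s :=
  if s is b :: s' then
    if (b.2 == 0) && (nopen s' == w) then (b.1, v) :: s'
    else b :: close_block v w s'
  else [::].

(** The scan stops at the longest suffix with [nopen r] open blocks. Since [l] is empty or ends
    open, every suffix starting inside [l] has more of them, so the scan reaches [r]. *)
Lemma open_blockE v l r :
  ends_open l -> open_block v (nopen r) (l ++ r) = l ++ (v, 0) :: r.
Proof.
elim: l => [|b l IH] hl; first by case: r => [|c r]; rewrite /= ?eqxx.
have h := ends_open_gt0 hl.
have -> : open_block v (nopen r) ((b :: l) ++ r) = b :: open_block v (nopen r) (l ++ r).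
  by rewrite /=; case: eqP => // e; move: h; rewrite nopen_cons;
    rewrite nopen_cons nopen_cat in e; lia.
rewrite IH //; case: (l) hl => [|c l'] //.
Qed.

(** Every block of [l] has [(a, 0)] to its right, hence more than [nopen r] open blocks there. *)
Lemma close_blockE v a l r :
  close_block v (nopen r) (l ++ (a, 0) :: r) = l ++ (a, v) :: r.
Proof.
elim: l => [|b l IH] /=; first by rewrite eqxx.
rewrite IH; case: ifP => // /andP[_ /eqP].
by rewrite nopen_cat nopen_cons /=; lia.
Qed.

Lemma split_closing w s : w < nopen s ->
  exists l a r, s = l ++ (a, 0) :: r /\ nopen r = w.
Proof.
elim: s => // -[a b] s IH; rewrite nopen_cons /= => h.
have [/andP[/eqP-> /eqP hw]|hn] := boolP ((b == 0) && (nopen s == w)).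
  by exists [::], a, s.
have hs : w < nopen s by move: h hn; case: (b == 0) => /=; lia.
by have [l [a' [r [-> hr]]]] := IH hs; exists ((a, b) :: l), a', r.
Qed.

(** The label [nopen s] means the far left; a smaller one cuts just after the open block that has
    [w] open blocks to its right. *)
Lemma split_opening w s : w <= nopen s ->
  exists l r, [/\ s = l ++ r, ends_open l & nopen r = w].
Proof.
rewrite leq_eqVlt => /orP[/eqP->|/split_closing[l [a [r [-> <-]]]]].
  by exists [::], s.
by exists (rcons l (a, 0)), r; rewrite cat_rcons /ends_open last_rcons.
Qed.

(** * Which insertions preserve the inequalities of a state *)

Lemma state_mem v N t y : state v N t -> y \in flat t -> (y == 0) || (v < y).
Proof.
case: y => [|y] // [h _ _]; rewrite -has_pred1 has_count h //.
by case: (v < y.+1).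
Qed.

Lemma state_mem_pair v N t b : state v N t -> b \in t ->
  (v < b.1) && ((b.2 == 0) || (v < b.2)).
Proof.
move=> st bt; have [_ /allP/(_ b bt) lt _] := st.
have h1 : b.1 \in flat t.
  by rewrite mem_flat; apply/hasP; exists b; rewrite // /has_val eqxx.
have h2 : b.2 \in flat t.
  by rewrite mem_flat; apply/hasP; exists b; rewrite // /has_val eqxx orbT.
by rewrite (state_mem st h2) andbT; move: (state_mem st h1); case: eqP lt => [->|].
Qed.

Lemma path_link_snd b c r : b.2 = c.2 -> path link b r = path link c r.
Proof. by case: r => //= d r e; rewrite /link e. Qed.

(** The new peak is the least positive value present, so the chain allows it only after a valley
    [0]: behind an open block or at the far left. Its own valley [0] leaves the condition on [r]
    unchanged. *)
Lemma state_open v N l r : v < N ->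
  state v N (l ++ (v.+1, 0) :: r) <-> state v.+1 N (l ++ r) /\ ends_open l.
Proof.
move=> vN.
have cnt x : 0 < x -> count_mem x (flat (l ++ (v.+1, 0) :: r))
    = count_mem x (flat (l ++ r)) + (v.+1 == x).
  by case: x => // x _; rewrite !flat_cat flat_cons !count_cat /=; lia.
split=> [st|[st lo]]; last first.
  have [h1 h2 h3] := st; split=> [x x0||].
  - by rewrite cnt // h1 //; lia.
  - by move: h2; rewrite !all_cat.
  - move: h3; rewrite !cat_path /= => /andP[-> hr]; rewrite /link (eqP lo) /=.
    by rewrite -(@path_link_snd (last (0,0) l)) // (eqP lo).
have [h1 h2 h3] := st; have lo : ends_open l.
  have := mem_last (0, 0) l; rewrite inE => /orP[/eqP e|hl]; first by rewrite /ends_open e.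
  have /(state_mem_pair st)/andP[_] : last (0, 0) l \in l ++ (v.+1, 0) :: r.
    by rewrite mem_cat hl.
  by move: h3; rewrite cat_path /= /link /= /ends_open => /and3P[_]; lia.
split=> //; split=> [x x0||].
- by move: (h1 x x0); rewrite cnt //; lia.
- by move: h2; rewrite !all_cat /= .
- move: h3; rewrite !cat_path /= => /and3P[-> _ hr] /=.
  by rewrite (@path_link_snd _ (v.+1, 0)) // (eqP lo).
Qed.

(** Closing is always legal: the positive values already present exceed [v.+1], so the new valley is
    below its own peak and the next one. *)
Lemma state_close v N a l r : v < N ->
  state v N (l ++ (a, v.+1) :: r) <-> state v.+1 N (l ++ (a, 0) :: r).
Proof.
move=> vN.
have cnt x : 0 < x -> count_mem x (flat (l ++ (a, v.+1) :: r))
    = count_mem x (flat (l ++ (a, 0) :: r)) + (v.+1 == x).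
  by case: x => // x _; rewrite !flat_cat !flat_cons !count_cat /=; lia.
split=> st; have [h1 h2 h3] := st; split=> [x x0||].
- by move: (h1 x x0); rewrite cnt //; lia.
- by move: h2; rewrite !all_cat /= => /and3P[-> + ->]; lia.
- move: h3; rewrite !cat_path /= {2}/link /= => /and3P[-> h]; rewrite /link h /=.
  by case: (r) => //= c r' /andP[+ ->]; rewrite /link /=; lia.
- by rewrite cnt // h1 //; lia.
- have /(state_mem_pair st) : (a, 0) \in l ++ (a, 0) :: r by rewrite mem_cat mem_head orbT.
  by move: h2; rewrite !all_cat /= => /and3P[-> _ ->]; lia.
- have : all (fun c => v.+1 < c.1) r.
    apply/allP => c cr; have /(state_mem_pair st)/andP[] //: c \in l ++ (a, 0) :: r.
    by rewrite mem_cat inE cr !orbT.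
  move: h3; rewrite !cat_path /= {2}/link /= => /and3P[-> h]; rewrite /link h /=.
  by case: (r) => //= c r' /andP[_ ->] /andP[+ _]; rewrite /link /= andbT.
Qed.

Lemma state_split v N t : v < N -> state v N t ->
  exists l r, t = l ++ (v.+1, 0) :: r \/ exists a, t = l ++ (a, v.+1) :: r.
Proof.
move=> vN st; have [h1 h2 _] := st.
have : v.+1 \in flat t by rewrite -has_pred1 has_count h1 // leqnn vN.
rewrite mem_flat => /hasP[[a b] bt hb]; move: (state_mem_pair st bt) => /= bb.
have /= lt := allP h2 _ bt.
case/splitPr: bt => l r; exists l, r.
case/orP: hb => /= /eqP e; last by right; exists a; rewrite e.
(* The peak is [v.+1]; its valley is smaller, and is [0] or above [v], hence [0]. *)
by left; congr (_ ++ (_, _) :: _); lia.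
Qed.

(** * Effect of an insertion on the inversion code *)

Lemma code_cons x b t :
  code x (b :: t) = if has_val x b then count (straddles x) t else code x t.
Proof. by rewrite /code /=; case: ifP => //= _; rewrite drop0. Qed.

(** A block [(x, 0)] straddles only values below [x], so the codes of the larger values stay
    fixed. *)
Lemma code_open_other x y l r : x < y -> code y (l ++ (x, 0) :: r) = code y (l ++ r).
Proof.
move=> xy; elim: l => [|b l IH] /=.
  by rewrite code_cons /has_val /=; case: ifP => //; lia.
rewrite !code_cons IH !count_cat /= /straddles /=.
by have -> : 0 < y < x = false by lia.
Qed.

Lemma code_close_other x y a l r : 0 < x < y ->
  code y (l ++ (a, x) :: r) = code y (l ++ (a, 0) :: r).
Proof.
move=> xy; elim: l => [|b l IH] /=.
  rewrite !code_cons /has_val /=.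
  by have [-> ->] : (x == y) = false /\ (0 == y) = false by split; lia.
rewrite !code_cons IH !count_cat /= /straddles /=.
by have -> : x < y < a = (0 < y < a) by lia.
Qed.

(** Peaks of [r] exceed [x] and its valleys are [0] or exceed [x], so the blocks of [r] straddling
    [x] are exactly the open ones. *)
Lemma code_new x b l r :
  has_val x b -> x \notin flat l ->
  all (fun c => (x < c.1) && ((c.2 == 0) || (x < c.2))) r -> 0 < x ->
  code x (l ++ b :: r) = nopen r.
Proof.
move=> xb xl xr x0; elim: l xl => [|c l IH] /=.
  move=> _; rewrite code_cons xb; apply: eq_in_count => c /(allP xr) /=.
  by rewrite /straddles; lia.
rewrite flat_cons !inE !negb_or eq_sym (eq_sym x) => /and3P[h1 h2 h3].
by rewrite code_cons /has_val (negbTE h1) (negbTE h2) IH.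
Qed.

(** * Insertions and letters determine each other *)

Definition place v (p : bool) w s :=
  if p then open_block v w s else close_block v w s.

Definition admissible (p : bool) w h := if p then w <= h else w < h.

Lemma word_recl v N t : v < N ->
  word v N t = rcons (word v.+1 N t) (v.+1 \in unzip1 t, code v.+1 t).
Proof.
move=> vN; rewrite /word -map_rcons -rev_cons.
by have -> : N - v = (N - v.+1).+1 by lia.
Qed.

Lemma eq_word v N s t :
  (forall x, v < x -> (x \in unzip1 s) = (x \in unzip1 t)) ->
  (forall x, v < x -> code x s = code x t) -> word v N s = word v N t.
Proof.
move=> h1 h2; apply/eq_in_map => x; rewrite mem_rev mem_iota => /andP[vx _].
by rewrite h1 ?h2.
Qed.

Lemma size_word v N t : size (word v N t) = N - v.
Proof. by rewrite size_map size_rev size_iota. Qed.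

Lemma state_notin v N t x : state v N t -> 0 < x <= v -> x \notin flat t.
Proof. by move=> st hx; apply/negP => /(state_mem st); lia. Qed.

Lemma notin_unzip1 x t : x \notin flat t -> x \notin unzip1 t.
Proof.
apply: contra => /mapP[b bt ->]; rewrite mem_flat; apply/hasP.
by exists b; rewrite // /has_val eqxx.
Qed.

(** The inserted value is the least one, so earlier letters survive and the new letter is the
    prescribed one. The height change, [+1] or [-1], is stated additively to avoid truncated
    subtraction. *)
Lemma state_place v N p w s :
  v < N -> state v.+1 N s -> admissible p w (nopen s) ->
  let t := place v.+1 p w s in
  [/\ state v N t, word v N t = rcons (word v.+1 N s) (p, w)
    & nopen t + ~~ p = nopen s + p].
Proof.
move=> vN st; case: p => /= h.
  have [l [r [es lo er]]] := split_opening h.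
  have et : open_block v.+1 w s = l ++ (v.+1, 0) :: r by rewrite es -er open_blockE.
  rewrite et; rewrite es in st *; split.
  - exact/state_open.
  - rewrite word_recl //; congr rcons.
      apply: eq_word => x vx; last by rewrite code_open_other.
      by rewrite /unzip1 !map_cat !mem_cat inE (gtn_eqF vx).
    congr pair; first by rewrite /unzip1 map_cat mem_cat inE eqxx orbT.
    rewrite code_new ?/has_val ?eqxx //.
      have /(state_notin st) : 0 < v.+1 <= v.+1 by rewrite leqnn.
      by rewrite flat_cat mem_cat negb_or => /andP[].
    by apply/allP=> c cr; apply: (state_mem_pair st); rewrite mem_cat cr orbT.
  - by rewrite !nopen_cat nopen_cons /=; lia.
have [l [a [r [es er]]]] := split_closing h.
have et : close_block v.+1 w s = l ++ (a, v.+1) :: r by rewrite es -er close_blockE.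
rewrite et; rewrite es in st *.
have /(state_notin st) nin : 0 < v.+1 <= v.+1 by rewrite leqnn.
split.
- exact/state_close.
- rewrite word_recl //; congr rcons.
    apply: eq_word => x vx; last by rewrite code_close_other.
    by rewrite /unzip1 !map_cat !mem_cat !inE.
  congr pair.
    by have := notin_unzip1 nin; rewrite /unzip1 !map_cat => /negbTE.
  rewrite code_new ?/has_val ?eqxx ?orbT //.
    by move: nin; rewrite flat_cat mem_cat negb_or => /andP[].
  by apply/allP=> c cr; apply: (state_mem_pair st); rewrite mem_cat inE cr !orbT.
- by rewrite !nopen_cat !nopen_cons /=; lia.
Qed.

Lemma state_unplace v N t : v < N -> state v N t ->
  exists s p w, [/\ state v.+1 N s, admissible p w (nopen s) & t = place v.+1 p w s].
Proof.
move=> vN st; have [l [r [et|[a et]]]] := state_split vN st.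
  move: st; rewrite et => /(state_open _ _ vN)[st lo].
  exists (l ++ r), true, (nopen r); split=> //=; last by rewrite open_blockE.
  by rewrite nopen_cat; lia.
move: st; rewrite et => /(state_close _ _ _ vN) st.
exists (l ++ (a, 0) :: r), false, (nopen r); split=> //=; last by rewrite close_blockE.
by rewrite nopen_cat nopen_cons /=; lia.
Qed.

Lemma state_top N t : state N N t <-> t = [::].
Proof.
split=> [st|->]; last by split=> // x _ /=; lia.
case: t st => // b t st; have /andP[h _] := state_mem_pair st (mem_head b t).
have [/(_ b.1) + _ _] := st; rewrite flat_cons /= eqxx => /(_ (leq_ltn_trans (leq0n _) h)).
by lia.
Qed.

(** The last letter of a word gives the arguments of the last [place], so both lists arise by the
    same insertion from states with equal words. *)
Lemma word_inj v N s t : v <= N -> state v N s -> state v N t ->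
  word v N s = word v N t -> s = t.
Proof.
(* Downward induction on [v], through the number [k] of inserted values. *)
move=> vN; have [k hk] : exists k, v + k = N by exists (N - v); lia.
elim: k v hk vN s t => [|k IH] v hk vN s t ss st.
  have e : v = N by lia.
  by subst v; move/state_top: ss => ->; move/state_top: st => ->.
have lt : v < N by lia.
have [s' [p [w [ss' a es]]]] := state_unplace lt ss.
have [t' [p' [w' [st' a' et]]]] := state_unplace lt st.
have [_ ws _] := state_place lt ss' a; have [_ wt _] := state_place lt st' a'.
rewrite es et ws wt => /rcons_inj[e -> ->].
by rewrite (IH v.+1 _ _ s' t') //; lia.
Qed.

(** * Words of states are the labeled ballot paths *)

Local Open Scope ring_scope.

Lemma yht_rcons P (p : bool) j : (j <= size P)%N -> yht (rcons P p) j = yht P j.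
Proof. by move=> h; rewrite /yht -cats1 takel_cat. Qed.

Lemma yht_rcons_size P (p : bool) :
  yht (rcons P p) (size P).+1 = yht P (size P) + (if p then 1 else -1).
Proof. by rewrite /yht -(size_rcons P p) !take_size -cats1 big_cat big_seq1. Qed.

(** One inequality covers both conditions on the new step: labels are nonnegative, so the bound on
    the label also keeps the endpoint of a down step above the axis. *)
Lemma labeled_ballot_rcons P W (p : bool) (w : nat) : size W = size P ->
  labeled_ballot (rcons P p) (rcons W w) =
  labeled_ballot P W && (Posz w <= yht P (size P) - (~~ p)%:Z).
Proof.
move=> hs; rewrite /labeled_ballot !size_rcons hs !eqxx !andTb.
have eh k : (k \in iota 1 (size P)) ->
    (Posz (nth 0%N (rcons W w) k.-1) <= step_height (rcons P p) k) =
    (Posz (nth 0%N W k.-1) <= step_height P k).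
  rewrite mem_iota => hk; rewrite /step_height yht_rcons; last by lia.
  by rewrite !nth_rcons hs; have -> : (k.-1 < size P)%N by lia.
have ey j : j \in iota 0 (size P).+1 -> (0 <= yht (rcons P p) j) = (0 <= yht P j).
  by rewrite mem_iota => hj; rewrite yht_rcons //; lia.
have iS m k : iota m k.+1 = iota m k ++ [:: (m + k)%N] by rewrite -addn1 iotaD.
rewrite (iS 1%N (size P)) (iS 0%N (size P).+1) !all_cat.
rewrite (eq_in_all eh) (eq_in_all ey) !all_seq1 add1n add0n.
rewrite yht_rcons_size /step_height yht_rcons // !nth_rcons hs ltnn eqxx.
have [h|] := boolP (all _ (iota 0 _)) => //.
have y0 : 0 <= yht P (size P).
  by move/allP: h; apply; rewrite mem_iota; lia.
case: (all _ (iota 1 _)); last by rewrite !andbF.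
rewrite !andTb; case: p {eh ey} => /=; lia.
Qed.

(** The height equals the number of open blocks, which makes [admissible] the label condition of the
    appended step. *)
Lemma labeled_word v N t : (v <= N)%N -> state v N t ->
  labeled_ballot (unzip1 (word v N t)) (unzip2 (word v N t)) /\
  yht (unzip1 (word v N t)) (N - v) = Posz (nopen t).
Proof.
move=> vN; have [k hk] : exists k, (v + k)%N = N by exists (N - v)%N; lia.
elim: k v hk vN t => [|k IH] v hk vN t st.
  have e : v = N by lia.
  subst v; move/state_top: st => ->; rewrite /word subnn /=.
  by split; rewrite /labeled_ballot /yht /= ?big_nil.
have lt : (v < N)%N by lia.
have [s [p [w [ss a ->]]]] := state_unplace lt st.
have [_ -> hn] := state_place lt ss a.
have [|||h1 h2] := IH v.+1 _ _ s => //; first by lia.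
have sz : size (unzip1 (word v.+1 N s)) = (N - v.+1)%N by rewrite size_map size_word.
have sz2 : size (unzip2 (word v.+1 N s)) = size (unzip1 (word v.+1 N s)).
  by rewrite !size_map.
rewrite /unzip1 /unzip2 !map_rcons labeled_ballot_rcons // h1 /=.
have -> : (N - v = (size (unzip1 (word v.+1 N s))).+1)%N by rewrite sz; lia.
rewrite -/(unzip1 _) yht_rcons_size sz h2.
move: a hn {h1 h2}; case: p => /=; lia.
Qed.

Lemma word_surj v N (pw : seq (bool * nat)) : (v <= N)%N -> size pw = (N - v)%N ->
  labeled_ballot (unzip1 pw) (unzip2 pw) -> exists2 t, state v N t & word v N t = pw.
Proof.
move=> vN; have [k hk] : exists k, (v + k)%N = N by exists (N - v)%N; lia.
elim: k v hk vN pw => [|k IH] v hk vN pw sz.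
  have e : v = N by lia.
  subst v => _; exists [::]; first exact/state_top.
  by rewrite /word subnn /=; case: pw sz => //= *; lia.
case/lastP: pw sz => [|pw [p w]]; rewrite ?size_rcons => sz; first by move: sz => /=; lia.
rewrite /unzip1 /unzip2 !map_rcons labeled_ballot_rcons ?size_map // => /andP[hl hw].
have [|||s ss es] := IH v.+1 _ _ pw _ hl; [lia|lia|lia|].
have lt : (v < N)%N by lia.
have [_] := labeled_word lt ss; rewrite es => hy.
(* The height before the last step is [nopen s], so the label bound is admissibility. *)
have a : admissible p w (nopen s).
  move: hw; have -> : (size pw = N - v.+1)%N by lia.
  by rewrite hy; case: (p) => /=; lia.
have [st et _] := state_place lt ss a.
by exists (place v.+1 p w s); rewrite // et es.
Qed.

(** * Positions and inversion codes in a flattened block list *)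

Lemma size_flat t : size (flat t) = (size t).*2.
Proof. by elim: t => // b t IH; rewrite flat_cons /= IH. Qed.

Lemma nth_flat_peak t j : nth 0%N (flat t) j.*2 = (nth (0, 0)%N t j).1.
Proof.
elim: t j => [|b t IH] [|j] //.
by rewrite doubleS flat_cons /= IH.
Qed.

Lemma nth_flat_valley t j : nth 0%N (flat t) j.*2.+1 = (nth (0, 0)%N t j).2.
Proof.
elim: t j => [|b t IH] [|j] //.
by rewrite doubleS flat_cons /= IH.
Qed.

Lemma flat_surj n (u : seq nat) : size u = n.*2 -> exists t, u = flat t.
Proof.
elim: n u => [|n IH] [|a [|b u]] //; first by exists [::].
rewrite doubleS => -[/IH[t ->]]; by exists ((a, b) :: t).
Qed.

Lemma pe_flat t i : pe (map Posz (flat t)) i.+1 = Posz (nth 0%N (flat t) i).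
Proof.
rewrite /pe /=; have [h|h] := ltnP i (size (flat t)); first by rewrite (nth_map 0%N).
by rewrite !nth_default ?size_map.
Qed.

Lemma pe_peak t j : pe (map Posz (flat t)) j.*2.+1 = Posz (nth (0, 0)%N t j).1.
Proof. by rewrite pe_flat nth_flat_peak. Qed.

Lemma pe_valley t j : pe (map Posz (flat t)) j.*2.+2 = Posz (nth (0, 0)%N t j).2.
Proof. by rewrite pe_flat nth_flat_valley. Qed.

Lemma pos_ofE (pi : seq int) v : pos_of pi v = (index v (map absz pi)).+1.
Proof. by rewrite /pos_of /index find_map. Qed.

Lemma absz_Posz (u : seq nat) : map absz (map Posz u) = u.
Proof. by rewrite -map_comp map_id. Qed.

Lemma index_flat x t : x \in flat t ->
  index x (flat t) =
  ((find (has_val x) t).*2 + ((nth (0, 0) t (find (has_val x) t)).1 != x))%N.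
Proof.
elim: t => // b t IH; rewrite flat_cons !inE /= [has_val x b]/(_ || _).
rewrite (eq_sym x) (eq_sym x); case: (altP (b.1 =P x)) => [->|n1] /=; first by rewrite eqxx.
case: (altP (b.2 =P x)) => [_ _|n2 /IH ->] /=; first by rewrite n1.
by rewrite doubleS.
Qed.

(** Peaks occupy the odd positions, counted from 1; uniqueness prevents a valley from recurring as a
    later peak. *)
Lemma odd_index_flat x t : uniq (flat t) -> x \in flat t ->
  odd (index x (flat t)).+1 = (x \in unzip1 t).
Proof.
elim: t => // b t IH; rewrite flat_cons cons_uniq inE => /andP[_].
rewrite cons_uniq => /andP[h2 u].
rewrite !inE /= (eq_sym x) (eq_sym x); case: (altP (b.1 =P x)) => //= n1.
case: (altP (b.2 =P x)) => [e _|n2 /= /(IH u)] /=; last by rewrite negbK.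
by rewrite e in h2; rewrite (negbTE (notin_unzip1 h2)).
Qed.

(** Turns the count over indices in [inv_code] into the count over a suffix in [code]. *)
Lemma count_nth_drop (T : Type) (d : T) (Q : pred T) (u : seq T) m :
  count (fun k => (m <= k)%N && Q (nth d u k)) (iota 0 (size u)) = count Q (drop m u).
Proof.
elim: u m => [|a u IH] m; first by case: m.
rewrite /= (iotaDl 1 0) count_map; case: m => [|m] /=.
  by congr (_ + _)%N; rewrite -(drop0 u) -IH; rewrite drop0; apply: eq_count.
by rewrite add0n -IH; apply: eq_count.
Qed.

Lemma inv_code_flat x t : x \in flat t ->
  inv_code (map Posz (flat t)) (index x (flat t)).+1 = code x t.
Proof.
move=> xt; rewrite /inv_code size_map size_flat odd_double.
have -> : ((size t).*2 %/ 2 = size t)%N by rewrite divn2 doubleK.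
rewrite (iotaDl 1 0) count_map /code -(count_nth_drop (0, 0)%N).
apply: eq_count => k; rewrite /preim !inE; cbv beta; rewrite pe_flat nth_index // /straddles.
have -> : (2 * (1 + k) = k.*2.+2)%N by lia.
rewrite pe_valley -[k.*2.+2.-1]/k.*2.+1 pe_peak !ltz_nat; congr (_ && _).
(* Both positions [2j+1] and [2j+2] of the block with index [j] precede position [2k+1] exactly when
   [j < k]. *)
by rewrite index_flat //; case: (_ != x) => /=; lia.
Qed.

Lemma rev_iota1 N : rev (iota 1 N) = [seq (N - k + 1)%N | k <- iota 1 N].
Proof.
apply: (@eq_from_nth _ 0%N); rewrite ?size_rev ?size_map // => i; rewrite size_iota => h.
rewrite nth_rev ?size_iota // (nth_map 0%N) ?size_iota // !nth_iota //; lia.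
Qed.

(** All entries are positive, so [Phi] takes only its branches for positive entries and no label is
    complemented. *)
Lemma Phi_flat N t : perm_eq (flat t) (iota 1 N) ->
  Phi (map Posz (flat t)) = (unzip1 (word 0 N t), unzip2 (word 0 N t)).
Proof.
move=> h; have sz : size (flat t) = N by rewrite (perm_size h) size_iota.
have u : uniq (flat t) by rewrite (perm_uniq h) iota_uniq.
rewrite /Phi /Phi_labels /Phi_path size_map sz /word subn0 rev_iota1.
rewrite /unzip1 /unzip2 -!map_comp.
have key k : k \in iota 1 N -> (N - k + 1)%N \in flat t.
  by rewrite (perm_mem h) !mem_iota; lia.
congr pair; apply/eq_in_map => k /key xt;
  rewrite pos_ofE absz_Posz pe_flat nth_index // ltz_nat addn_gt0 orbT.
  exact: odd_index_flat.
exact: inv_code_flat.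
Qed.

(** * Alternating permutations are the states without open blocks *)

Lemma zigzag_flat t :
  zigzag (map Posz (flat t)) = all (fun b => b.2 < b.1)%N t && sorted link t.
Proof.
rewrite /zigzag size_map size_flat; apply/allP/andP => [h|[/(all_nthP (0, 0)%N) h1]].
  split; first (apply/(all_nthP (0, 0)%N) => i hi).
    have := h i.*2.+1; rewrite mem_iota /= odd_double /= pe_peak pe_valley ltz_nat.
    by apply; lia.
  apply/(sortedP (0, 0)%N) => i hi.
  have := h i.*2.+2; rewrite mem_iota /= odd_double /= pe_valley -doubleS pe_peak ltz_nat.
  by apply; lia.
move/(sortedP (0, 0)%N) => h2 k; rewrite mem_iota => hk.
have := odd_double_half k; case: (odd k) => /= ek.
  by rewrite -ek add1n pe_peak pe_valley ltz_nat h1 //; lia.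
have [j ej] : exists j, k = j.*2.+2 by exists (k./2.-1); lia.
by rewrite ej pe_valley -doubleS pe_peak ltz_nat; apply: h2; lia.
Qed.

Lemma alternating_flat N t :
  alternating N (map Posz (flat t)) <-> state 0 N t /\ nopen t = 0%N.
Proof.
rewrite /alternating /signed_perm absz_Posz zigzag_flat all_map.
(* The link from the sentinel [(0, 0)] only says that the first peak is positive, which holds as it
   exceeds its valley. *)
have pathE : all (fun b => b.2 < b.1)%N t -> path link (0, 0)%N t = sorted link t.
  by case: t => //= b t /andP[h _]; rewrite /link /= (leq_ltn_trans _ h).
split=> [/and4P[hp /allP h0 h1 h2]|[[hc h1 h2] h0]].
  split; first (split=> //; last by rewrite pathE).
    move=> x x0; rewrite (permP hp) (count_uniq_mem _ (iota_uniq 1 N)) mem_iota.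
    by rewrite add1n ltnS x0.
  apply/eqP; rewrite /nopen -leqn0 leqNgt -has_count; apply/hasPn => b bt.
  apply: lt0n_neq0; rewrite -ltz_nat; apply: h0; rewrite mem_flat; apply/hasP.
  by exists b; rewrite // /has_val eqxx orbT.
(* A peak exceeds its valley, so [0] could only be a valley, that is an open block. *)
have n0 : 0%N \notin flat t.
  rewrite mem_flat; apply/hasPn => b bt; rewrite /has_val negb_or.
  move/allP/(_ _ bt): h1 => h1; rewrite -lt0n (leq_ltn_trans _ h1) //=.
  apply/negP => hb; suff : (0 < nopen t)%N by rewrite h0.
  by rewrite -has_count; apply/hasP; exists b.
rewrite h1 -pathE // h2 !andbT; apply/andP; split.
  apply/allP => x _ /=; rewrite (count_uniq_mem _ (iota_uniq 1 N)) mem_iota.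
  case: x => [|x]; first by rewrite (count_memPn n0).
  by rewrite hc // add1n ltnS.
by apply/allP => x xt /=; rewrite ltz_nat lt0n; apply: contraNneq n0 => <-.
Qed.

Lemma alternating_blocks n (pi : seq int) : alternating (2 * n) pi ->
  exists t, [/\ pi = map Posz (flat t), state 0 (2 * n) t & nopen t = 0%N].
Proof.
move=> a; have /and3P[hp /allP h0 _] := a.
have e : pi = map Posz (map absz pi).
  rewrite -map_comp -[LHS]map_id; apply/eq_in_map => x /h0 /=; lia.
have [|t et] := @flat_surj n (map absz pi).
  by rewrite (perm_size hp) size_iota mul2n.
rewrite et in e; exists t; rewrite e in a.
by have [? ?] := (alternating_flat _ _).1 a.
Qed.

Lemma alternating_Phi n (pi : seq int) : alternating (2 * n) pi ->
  exists t, [/\ pi = map Posz (flat t), state 0 (2 * n) t, nopen t = 0%N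
    & Phi pi = (unzip1 (word 0 (2 * n) t), unzip2 (word 0 (2 * n) t))].
Proof.
move=> a; have [t [e st h0]] := alternating_blocks a.
exists t; split=> //; rewrite e; apply: Phi_flat.
by move: a; rewrite e => /and3P[]; rewrite /signed_perm absz_Posz.
Qed.

(** * Bijectivity of [Phi] on alternating permutations *)

Lemma zip_unzip_inj (S T : Type) (u v : seq (S * T)) :
  unzip1 u = unzip1 v -> unzip2 u = unzip2 v -> u = v.
Proof. by move=> e1 e2; rewrite -(zip_unzip u) e1 e2 zip_unzip. Qed.

Lemma Phi_dyck n (pi : seq int) :
  alternating (2 * n) pi -> labeled_dyck (2 * n) (Phi pi).
Proof.
move=> /alternating_Phi[t [_ st h0 ->]].
have [h1 h2] := labeled_word (leq0n _) st.
rewrite /labeled_dyck /labeled_ballot_to /= h1 size_map size_word subn0 eqxx /=.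
by rewrite subn0 h0 in h2; rewrite h2.
Qed.

Lemma Phi_inj n (pi1 pi2 : seq int) :
  alternating (2 * n) pi1 -> alternating (2 * n) pi2 -> Phi pi1 = Phi pi2 -> pi1 = pi2.
Proof.
move=> /alternating_Phi[t1 [-> st1 _ ->]] /alternating_Phi[t2 [-> st2 _ ->]] [e1 e2].
by rewrite (word_inj _ st1 st2) //; apply: zip_unzip_inj.
Qed.

Lemma Phi_surj n P W : labeled_dyck (2 * n) (P, W) ->
  exists pi : seq int, alternating (2 * n) pi /\ Phi pi = (P, W).
Proof.
move=> /and3P[/= hl /eqP sz /eqP hy].
have sW : size W = size P by case/and3P: hl => /eqP.
have [||t st et] := @word_surj 0 (2 * n) (zip P W) (leq0n _).
- by rewrite size_zip sW minnn subn0.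
- by rewrite unzip1_zip ?unzip2_zip ?sW.
have [_] := labeled_word (leq0n _) st.
(* The path ends on the axis, so no block remains open. *)
rewrite et unzip1_zip ?sW // subn0 hy => -[h0].
have a : alternating (2 * n) (map Posz (flat t)) by apply/alternating_flat.
exists (map Posz (flat t)); split=> //; rewrite (@Phi_flat (2 * n)).
  by rewrite et unzip1_zip ?unzip2_zip ?sW.
by case/and3P: a; rewrite /signed_perm absz_Posz.
Qed.

(** * Counting labeled Dyck paths *)

Lemma step_height_le P k : step_height P k <= Posz k.
Proof.
have h j : yht P j <= Posz j.
  apply: (@le_trans _ _ (Posz (size (take j P)))); last by rewrite lez_nat size_take_min geq_minl.
  rewrite /yht; elim: (take j P) => [|b u IH]; first by rewrite big_nil.
  by rewrite big_cons [size _]/= intS lerD //; case: b.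
by have := h k.-1; rewrite /step_height; case: nth; lia.
Qed.

Lemma labeled_dyck_bound N P W : labeled_dyck N (P, W) -> all (fun w => w < N.+1)%N W.
Proof.
move=> /and3P[/and3P[/= /eqP sW _ /allP h] /eqP sz _].
apply/(all_nthP 0%N) => i hi.
have := h i.+1; rewrite mem_iota /= => /(_ _)/le_trans/(_ (step_height_le _ _)).
by move=> hh; have := hh _; lia.
Qed.

(** Both finite enumerations are mapped injectively into pairs of sequences, by [f] and by [Phi],
    and the images have the same members. *)
Lemma card_labeled_dyck n : B (2 * n) 0 = euler_num (2 * n).
Proof.
rewrite /B /euler_num; set N := (2 * n)%N; set X := [set _ | _].
pose f (pw : N.-tuple bool * N.-tuple 'I_N.+1) :=
  (val pw.1, map (@nat_of_ord _) (val pw.2)).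
have f_inj : injective f.
  move=> [p w] [p' w'] [/val_inj -> /(inj_map (@ord_inj _)) h].
  by rewrite (val_inj h).
rewrite -size_filter cardE -(size_map f).
rewrite -[RHS](size_map (fun u : seq nat => Phi (map Posz u))).
apply/perm_size/uniq_perm.
- by rewrite map_inj_uniq ?enum_uniq.
- rewrite map_inj_in_uniq ?filter_uniq ?permutations_uniq // => u u'.
  rewrite !mem_filter => /andP[a _] /andP[a' _] /(Phi_inj a a').
  by apply: inj_map => ? ? [].
move=> [P W]; apply/mapP/mapP => [[pw]|[u]].
  rewrite mem_enum inE => h e; rewrite /f in e; rewrite -e in h.
  have [pi [a ep]] := Phi_surj h; have [t [et _ _]] := alternating_blocks a.
  exists (flat t); last by rewrite -et.
  rewrite mem_filter -et a mem_permutations /=.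
  by case/and3P: a => + _ _; rewrite et /signed_perm absz_Posz perm_sym.
rewrite mem_filter => /andP[/Phi_dyck + _] => + e; rewrite -e => h.
have /and3P[/and3P[/= /eqP sW _ _] sz _] := h.
(* Every label is below [N.+1], so lifting the labels to ordinals discards none. *)
have sW' : size (pmap (insub : nat -> option 'I_N.+1) W) == N.
  have := labeled_dyck_bound h; rewrite size_pmap_sub all_count => /eqP ->.
  by rewrite sW.
have eW : map (@nat_of_ord _) (pmap (insub : nat -> option 'I_N.+1) W) = W.
  rewrite -[map _ _]/(map val _) pmap_filter; last exact: insubK.
  apply/all_filterP; apply: sub_all (labeled_dyck_bound h) => x hx.
  by rewrite insubT.
by exists (Tuple sz, Tuple sW'); rewrite ?mem_enum ?inE /f /= ?eW.
Qed.

(** * Snakes sent to labeled Dyck paths *)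

Definition parity_sign (pi : seq int) i : int :=
  if (if 0 < pe pi i then odd i else ~~ odd i) then 1 else -1.

(** The final height does not depend on the order of the steps, so the sum over values may be taken
    over positions. *)
Lemma yht_Phi_path N (pi : seq int) : signed_perm N pi ->
  yht (Phi_path pi) N = \sum_(0 <= i < N) parity_sign pi i.+1.
Proof.
move=> hp; have sz : size pi = N by rewrite -(size_map absz) (perm_size hp) size_iota.
have u : uniq (map absz pi) by rewrite (perm_uniq hp) iota_uniq.
rewrite /yht take_oversize /Phi_path; last by rewrite size_map size_iota sz.
rewrite big_map sz -(big_map (fun k => (N - k + 1)%N) xpredT
  (fun x => parity_sign pi (pos_of pi x))) -rev_iota1.
rewrite (perm_big (map absz pi)) /=; last by rewrite perm_rev perm_sym.
rewrite big_map (big_nth 0) sz !big_nat; apply: eq_bigr => i hi.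
by rewrite pos_ofE -(nth_map 0 0%N) ?index_uniq ?size_map ?sz.
Qed.

Lemma sum_pairs n (g : nat -> int) :
  \sum_(0 <= i < 2 * n) g i = \sum_(0 <= j < n) (g (2 * j)%N + g (2 * j).+1).
Proof.
elim: n => [|n IH]; first by rewrite !big_geq.
by rewrite mulnS !big_nat_recr //= IH addrA.
Qed.

(* Pairing the steps of positions [2j+1] and [2j+2] gives a nonnegative
   contribution, which vanishes only when both entries have the same sign. *)
Lemma snake_dyck_pos n (pi : seq int) :
  snake (2 * n) pi -> labeled_dyck (2 * n) (Phi pi) -> all (fun z : int => 0 <= z) pi.
Proof.
move=> /and3P[hp h0 /allP hz] /and3P[_ _ /eqP /=]; rewrite yht_Phi_path // sum_pairs.
have sz : size pi = (2 * n)%N by rewrite -(size_map absz) (perm_size hp) size_iota.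
have down j : (j < n)%N -> pe pi (2 * j).+2 < pe pi (2 * j).+1.
  move=> hj; have := hz (2 * j).+1; rewrite mem_iota sz /= mul2n odd_double /=.
  by apply; lia.
have up j : (j.+1 < n)%N -> pe pi (2 * j).+2 < pe pi (2 * j).+3.
  move=> hj; have := hz (2 * j).+2; rewrite mem_iota sz /= mul2n odd_double /=.
  by apply; lia.
have ps1 j : parity_sign pi (2 * j).+1 = if 0 < pe pi (2 * j).+1 then 1 else -1.
  by rewrite /parity_sign oddS oddM /=; case: (0 < _).
have ps2 j : parity_sign pi (2 * j).+2 = if 0 < pe pi (2 * j).+2 then -1 else 1.
  by rewrite /parity_sign !oddS oddM /=; case: (0 < _).
rewrite big_mkord => /psumr_eq0P hs.
have pair0 j : (j < n)%N -> 0 < pe pi (2 * j).+1 -> 0 < pe pi (2 * j).+2.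
  move=> hj h1; have := hs _ (Ordinal hj) isT; rewrite /= ps1 ps2 h1.
  case: ifP => // _ /(_ _) H; suff : (1 + 1 : int) = 0 by [].
  apply: H => i _; rewrite ps1 ps2; have := down i (ltn_ord i).
  by case: ifP; case: ifP => //; lia.
(* Positivity spreads from the first entry: a positive peak forces a positive valley by [pair0], and
   the next peak is larger by [up]. *)
have peak j : (j < n)%N -> 0 < pe pi (2 * j).+1.
  elim: j => [|j IH] hj //; rewrite mulnS; apply: lt_trans (up _ hj).
  by apply: pair0; [lia|apply: IH; lia].
apply/(all_nthP 0) => i; rewrite sz => hi; apply: ltW.
have := odd_double_half i; rewrite -mul2n => ei.
have hj : (i./2 < n)%N by lia.
case: (odd i) ei => /= ei; rewrite -ei ?add0n ?add1n; last exact: peak.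
exact: pair0 (peak _ hj).
Qed.

Local Close Scope ring_scope.

Theorem theorem4p6 (n : nat) (hn : 1 <= n) :
  [/\ (* Phi maps alternating permutations of [2n] to labeled Dyck paths *)
      (forall pi : seq int, alternating (2 * n) pi -> labeled_dyck (2 * n) (Phi pi)),
      (* injectively *)
      (forall pi1 pi2 : seq int, alternating (2 * n) pi1 -> alternating (2 * n) pi2 ->
         Phi pi1 = Phi pi2 -> pi1 = pi2),
      (* onto the labeled Dyck paths of length 2n *)
      (forall (P : seq bool) (W : seq nat), labeled_dyck (2 * n) (P, W) ->
         exists pi : seq int, alternating (2 * n) pi /\ Phi pi = (P, W)),
      (* equivalently: the snakes mapped to labeled Dyck paths have no negative entries *)
      (forall pi : seq int, snake (2 * n) pi -> labeled_dyck (2 * n) (Phi pi) ->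
         all (fun x => 0 <= x)%R pi)
    & B (2 * n) 0 = euler_num (2 * n)].
Proof.
split.
- exact: Phi_dyck.
- exact: Phi_inj.
- exact: Phi_surj.
- exact: snake_dyck_pos.
- exact: card_labeled_dyck.
Qed.
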